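(* There is an absolute constant $c>0$ such that for every $n\ge 1$, every instance $(H,A)$ of the Token Meeting Problem on $n$ nodes with $H$ connected has a solution with at most $c\,n^2$ swaps and at most $c\,n^2$ steps. (That is, every instance has a solution with $\mathcal{O}(n^2)$ swaps and $\mathcal{O}(n^2)$ steps.)
   Context: Graphs are finite, simple and undirected. An instance of the Token Meeting Problem (TMP) is a pair $(H,A)$ of graphs $H=(V,E)$ (nodes $V$, edges $E$) and $A=(Q,C)$ (tokens $Q$, connections $C$) with $|V|=|Q|=n$. A solution $(f_1,\mathcal{S})$ consists of a bijection $f_1:Q\to V$ and a finite sequence $\mathcal{S}=(M_1,\dots,M_k)$, $k\ge 0$, of (possibly empty) matchings $M_i\subseteq E$ such that for each $\{p,q\}\in C$ there is $t\in\{1,\dots,k+1\}$ with $\{f_t(p),f_t(q)\}\in E$, where for $t>1$, $f_t:=\pi_{M_{t-1}}\circ f_{t-1}$ and $\pi_M:V\to V$ is the product of the transpositions $\tau_{uv}$ over all $\{u,v\}\in M$. The number of steps of the solution is $k$ and its number of swaps is $\sum_{t=1}^k|M_t|$. *)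

(* Defs.v *)
From HB Require Import structures.
From mathcomp Require Import all_boot all_fingroup.
Set Implicit Arguments.
Unset Strict Implicit.
Unset Printing Implicit Defensive.

Record sgraph (V : finType) := SGraph {
  edges :> {set {set V}};
  edges_card2 : forall e, e \in edges -> #|e| = 2
}.

Definition adj (V : finType) (G : sgraph V) : rel V :=
  [rel u v | [set u; v] \in edges G].

(* Only meant for nonempty V: on an empty vertex type it holds vacuously. *)
Definition connected (V : finType) (G : sgraph V) : Prop :=
  forall u v : V, connect (adj G) u v.

Definition matching (V : finType) (G : sgraph V) (M : {set {set V}}) : bool :=
  (M \subset edges G) && trivIset M.

(* tperm u v for e = {u, v}; the choice of the ordered pair is immaterial
   by tpermC. The default 1 is only used when e does not have two elements. *)
Definition edge_swap (V : finType) (e : {set V}) : {perm V} :=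
  if [pick p : V * V | (p.1 != p.2) && (e == [set p.1; p.2])] is Some p
  then tperm p.1 p.2 else 1%g.

(* For a matching M the factors have disjoint supports, hence commute, so the
   order in which the big operator enumerates M is immaterial. *)
Definition matching_perm (V : finType) (M : {set {set V}}) : {perm V} :=
  (\prod_(e in M) edge_swap e)%g.

(* Indices start at 0: placement f S i is the placement after the first i
   matchings of S, usually written f_(i+1), with f = f_1. *)
Fixpoint placement (V Q : finType) (f : Q -> V) (S : seq {set {set V}})
    (i : nat) : Q -> V :=
  if i is j.+1 then matching_perm (nth set0 S j) \o placement f S j else f.

Record tmp_solution (V Q : finType) (H : sgraph V) (A : sgraph Q)
    (f : Q -> V) (S : seq {set {set V}}) : Prop := TMPSolution {
  tmp_bij : bijective f;
  tmp_matching : forall M, M \in S -> matching H M;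
  tmp_meet : forall p q : Q, [set p; q] \in edges A ->
    exists2 i, i <= size S &
      [set placement f S i p; placement f S i q] \in edges H
}.

Definition num_steps (V : finType) (S : seq {set {set V}}) : nat := size S.

Definition num_swaps (V : finType) (S : seq {set {set V}}) : nat :=
  \sum_(M <- S) #|M|.

(* Main.v *)
Require Import Defs.
From mathcomp Require Import all_boot all_fingroup.

(** It is enough to make every two tokens meet, using only matchings that
    consist of a single edge, so that steps and swaps are the same thing.

    Let a token [p] walk along a walk of [H] that visits every node, swapping
    at each step with the token on the next node.  Any other token [q] stays
    put until [p] swaps with it; since the walk reaches the node of [q], such
    a swap must happen, and just before it [p] and [q] are adjacent
    ([walk_meets]).  So a single walk makes [p] meet all other tokens, wherever
    these have been moved before.

    A connected graph on [n] nodes has such a walk of length at most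
    [2 * (n - 1)] from any given node ([covering_walk]).  Letting the [n]
    tokens walk in turn ([all_meet]) therefore costs at most [2 * n ^ 2]
    swaps. *)

Set Implicit Arguments.
Unset Strict Implicit.
Unset Printing Implicit Defensive.

Section Graph.

Variables (V : finType) (H : sgraph V).

Lemma edge_neq (u v : V) : [set u; v] \in edges H -> u != v.
Proof. by move=> /edges_card2; rewrite cards2; case: (u != v). Qed.

Lemma adj_sym : symmetric (adj H).
Proof. by move=> u v; rewrite /adj /= setUC. Qed.

Lemma matching_edge (e : {set V}) : e \in edges H -> matching H [set e].
Proof.
move=> eH; rewrite /matching sub1set eH; apply/trivIsetP => A B.
by rewrite !inE => /eqP-> /eqP->; rewrite eqxx.
Qed.

Lemma matching_perm_edge (u v : V) :
  u != v -> matching_perm [set [set u; v]] = tperm u v.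
Proof.
move=> neq_uv; rewrite /matching_perm big_set1 /edge_swap.
case: pickP => [[a b] /= /andP[neq_ab /eqP eq_uv] | /(_ (u, v))]; last first.
  by rewrite /= neq_uv eqxx.
have := set21 u v; have := set22 u v; rewrite eq_uv !inE.
case/orP=> /eqP vE; case/orP=> /eqP uE; subst=> //; rewrite ?eqxx // in neq_uv *.
exact: tpermC.
Qed.

(** Each new node [w] next to a visited node [u] is added to the walk by the
    detour [u, w, u], at the cost of two steps; connectedness provides such
    a [w] as long as some node is left out. *)
Lemma covering_walk (x : V) :
  connected H ->
  exists s, [/\ path (adj H) x s, size s <= 2 * #|V|.-1
              & forall v, v \in x :: s].
Proof.
move=> connH.
suff /(_ #|V|.-1) [s [s_path s_size [s_all|card_s]]] : forall k, exists s,
    [/\ path (adj H) x s, size s <= 2 * k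
      & (forall v, v \in x :: s) \/ k < #|[set v in x :: s]|].
- by exists s.
- have /setP s_full : [set v in x :: s] = setT.
    by apply/eqP; rewrite eqEcard subsetT cardsT (leq_trans (leqSpred _)).
  by exists s; split=> // v; have := s_full v; rewrite !inE.
elim=> [|k [s [s_path s_size s_cover]]].
  exists [::]; split=> //; right.
  by apply/card_gt0P; exists x; rewrite inE mem_head.
have s_size' : size s <= 2 * k.+1 by rewrite (leq_trans s_size) ?leq_mul.
case: s_cover => [s_all | s_card]; first by exists s; split; last left.
case: (pickP (fun p : V * V => [&& adj H p.1 p.2, p.1 \in x :: s
                                 & p.2 \notin x :: s]))
    => [[u w] /= /and3P[uw u_s w_s] | s_closed]; last first.
  exists s; split=> //; left=> v.
  have closed_s : closed (adj H) (mem (x :: s)).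
    apply: intro_closed; first exact: sym_connect_sym adj_sym.
    move=> u w uw /= u_s; have := s_closed (u, w).
    by rewrite /= uw u_s /= => /negbFE.
  by have <- := closed_connect closed_s (connH x v); rewrite /= mem_head.
have s'E: exists2 s', path (adj H) x s' /\ size s' = (size s).+2
                    & {subset w :: x :: s <= x :: s'}.
  case/splitPl: u_s s_path => p1 p2 lastp1; rewrite cat_path lastp1.
  case/andP=> p1_path p2_path; exists (p1 ++ [:: w, u & p2]).
    rewrite cat_path lastp1 p1_path /= uw adj_sym uw p2_path.
    by rewrite !size_cat /= !addnS.
  move=> z; rewrite !(inE, mem_cat).
  by case/or4P=> ->; rewrite ?orbT.
case: s'E => s' [s'_path s'_size] sub_s'; exists s'; split=> //.
  by rewrite s'_size mulnS.
right; apply: leq_ltn_trans s_card _; apply: proper_card.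
apply/properP; split.
  by apply/subsetP=> z; rewrite !inE => z_s; have := sub_s' z;
     rewrite !inE z_s orbT => ->.
exists w; last by rewrite inE.
by rewrite inE sub_s' ?mem_head.
Qed.

End Graph.

Section Meeting.

Variables (V Q : finType) (H : sgraph V).
Implicit Types (f : Q -> V) (S : seq {set {set V}}).

Definition meets f S (p q : Q) : Prop :=
  exists2 i, i <= size S &
    [set placement f S i p; placement f S i q] \in edges H.

Lemma placement_cons f M S i :
  placement f (M :: S) i.+1 = placement (matching_perm M \o f) S i.
Proof. by elim: i => //= i <-. Qed.

Lemma placement_catl f S1 S2 i :
  i <= size S1 -> placement f (S1 ++ S2) i = placement f S1 i.
Proof.
by elim: i => //= i IHi lt_i; rewrite nth_cat lt_i IHi // ltnW.
Qed.

Lemma placement_catr f S1 S2 i :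
  placement f (S1 ++ S2) (size S1 + i) =
    placement (placement f S1 (size S1)) S2 i.
Proof.
elim: i => [|i IHi]; first by rewrite addn0 placement_catl.
by rewrite addnS /= IHi nth_cat ltnNge leq_addr addKn.
Qed.

Lemma placement_inj f S i : injective f -> injective (placement f S i).
Proof. by move=> f_inj; elim: i => //= i IHi; apply: inj_comp perm_inj IHi. Qed.

Lemma meets_cons f M S p q :
  meets (matching_perm M \o f) S p q -> meets f (M :: S) p q.
Proof. by case=> i le_i mi; exists i.+1; rewrite ?placement_cons. Qed.

Lemma meets_catl f S1 S2 p q : meets f S1 p q -> meets f (S1 ++ S2) p q.
Proof.
case=> i le_i mi; exists i; last by rewrite placement_catl.
by rewrite size_cat (leq_trans le_i) ?leq_addr.
Qed.

Lemma meets_catr f S1 S2 p q :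
  meets (placement f S1 (size S1)) S2 p q -> meets f (S1 ++ S2) p q.
Proof.
case=> i le_i mi; exists (size S1 + i); last by rewrite placement_catr.
by rewrite size_cat leq_add2l.
Qed.

Fixpoint walk_swaps (x : V) (s : seq V) : seq {set {set V}} :=
  if s is y :: s' then [set [set x; y]] :: walk_swaps y s' else [::].

Lemma size_walk_swaps x s : size (walk_swaps x s) = size s.
Proof. by elim: s x => //= y s IHs x; rewrite IHs. Qed.

Lemma walk_swaps_edge x s M :
  path (adj H) x s -> M \in walk_swaps x s ->
  exists2 e, e \in edges H & M = [set e].
Proof.
elim: s x => //= y s IHs x /andP[xy /IHs{}IHs].
by rewrite inE => /predU1P[-> | /IHs //]; exists [set x; y].
Qed.

(** By induction on the walk: [q] does not move before the walk of [p] reaches it, and just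
    before being reached it is adjacent to [p]. *)
Lemma walk_meets f s p q :
  injective f -> p != q -> path (adj H) (f p) s -> f q \in s ->
  meets f (walk_swaps (f p) s) p q.
Proof.
elim: s f => //= y s IHs f f_inj neq_pq /andP[fpy s_path].
have [fqy _ | neq_fqy] := eqVneq (f q) y; first by exists 0; rewrite //= fqy.
rewrite inE (negPf neq_fqy) /= => fq_s; apply: meets_cons.
have swapE := matching_perm_edge (edge_neq fpy).
set g := _ \o f.
have gp : g p = y by rewrite /g /= swapE tpermL.
have gq : g q = f q.
  by rewrite /g /= swapE tpermD // ?(inj_eq f_inj) // eq_sym.
rewrite -gp; apply: IHs; rewrite ?gp ?gq //.
exact: inj_comp perm_inj f_inj.
Qed.

(** One walk per token of [ps], each starting where the previous walks have
    left that token: [walk_meets] holds for every placement, so nothing has to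
    be moved back between two walks. *)
Lemma all_meet (ps : seq Q) f :
  connected H -> injective f ->
  exists S, [/\ forall M, M \in S -> exists2 e, e \in edges H & M = [set e],
                size S <= size ps * (2 * #|V|.-1)
              & forall p q, p \in ps -> p != q -> meets f S p q].
Proof.
move=> connH; elim: ps f => [|p ps IHps] f f_inj; first by exists [::].
have [s [s_path s_size s_all]] := covering_walk (f p) connH.
pose S1 := walk_swaps (f p) s.
have [S2 [S2_edge S2_size S2_meet]] :=
  IHps _ (@placement_inj f S1 (size S1) f_inj).
exists (S1 ++ S2); split=> [M||p' q].
- by rewrite mem_cat => /orP[/(walk_swaps_edge s_path) | /S2_edge].
- by rewrite size_cat size_walk_swaps /= mulSn leq_add.
rewrite inE => /predU1P[-> neq_pq | p'_ps neq_pq].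
  apply/meets_catl/walk_meets => //; have := s_all (f q).
  by rewrite inE (inj_eq f_inj) eq_sym (negPf neq_pq).
exact/meets_catr/S2_meet.
Qed.

End Meeting.

Theorem theorem3p5 :
  exists c : nat, 0 < c /\
    forall (n : nat) (V Q : finType) (H : sgraph V) (A : sgraph Q),
      1 <= n -> #|V| = n -> #|Q| = n -> connected H ->
      exists (f : Q -> V) (S : seq {set {set V}}),
        [/\ tmp_solution H A f S,
            num_swaps S <= c * n ^ 2 &
            num_steps S <= c * n ^ 2].
Proof.
exists 2; split=> // n V Q H A _ cardV cardQ connH.
have cardQV : #|Q| = #|V| by rewrite cardV.
have [f f_bij] : exists f : Q -> V, bijective f.
  exists (enum_val \o cast_ord cardQV \o enum_rank).
  apply: inj_card_bij; last by rewrite cardQV.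
  exact: inj_comp (inj_comp enum_val_inj (@cast_ord_inj _ _ _)) enum_rank_inj.
have [S [S_edge S_size S_meet]] := all_meet (enum Q) connH (bij_inj f_bij).
have S_bound : size S <= 2 * n ^ 2.
  apply: leq_trans S_size _; rewrite -cardT cardQ cardV mulnCA -mulnn.
  by rewrite !leq_mul ?leq_pred.
have swapsE : num_swaps S = size S.
  rewrite /num_swaps -sum1_size; apply: eq_big_seq => M /S_edge[e _ ->].
  exact: cards1.
exists f, S; rewrite swapsE; split=> //; split=> // [M /S_edge[e eH ->] | p q].
  exact: matching_edge.
by move/edge_neq => neq_pq; apply: S_meet; rewrite ?mem_enum.
Qed.
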